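(* Let $\omega>0$, let $\mathcal N$ be a good neighbourhood of the origin with $\mathcal N=\mathcal N_*\sqcup(-\mathcal N_* )$, and assume that $\mathbb P$ is stationary and ergodic, that $L^2(\mathbb P)$ is separable, that the conductance field is covariant and that $\mathbb E[c_{0,z}^2]<+\infty$ for all $z\in\mathcal N$. Let $\theta_k=(i\omega-\mathbb L)^{-1}\gamma_k\in L^2(\mathbb P)$, $k=1,\dots,d$. Then the matrix $\sigma(\omega)$ satisfies, for all $j,k\in\{1,\dots,d\}$, $$\sigma(\omega)_{j,k}=2\sum_{z\in\mathcal N_*}\mathbb E\big[c_{0,z}\,z_j\big(z_k+\nabla\theta_k(\cdot,z)\big)\big].$$ Equivalently, in matrix form, $$\sigma(\omega)=2\sum_{z\in\mathcal N_*}\mathbb E\big[\Lambda(z)\big(\mathcal Z(z)+\Psi(z)\big)\big],$$ where $\Lambda_{jk}(z):=c_{0,z}(\xi)z_j\delta_{jk}$, $\mathcal Z_{jk}(z):=z_k$ and $\Psi_{jk}(z):=\nabla\theta_k(\xi,z)$. In the nearest-neighbour case ($\mathcal N=\{z\in\mathbb Z^d:|z|=1\}$, $\mathcal N_*=\{e_1,\dots,e_d\}$ the canonical basis) these formulas become $$\sigma(\omega)_{j,k}=2\,\mathbb E\big[c_{0,e_j}\big(\delta_{jk}+\nabla\theta_k(\cdot,e_j)\big)\big]\qquad\text{and}\qquad \sigma(\omega)=2\,\mathbb E\big[\Lambda(\mathbb I+\Psi)\big],$$ with $\Lambda_{jk}=c_{0,e_j}\delta_{jk}$, $\Psi_{jk}=\nabla\theta_k(\xi,e_j)$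 and $\mathbb I$ the identity matrix.
   Context: **Good neighbourhood.** $\mathcal N\subset\mathbb Z^d\setminus\{0\}$ is a good neighbourhood of the origin if it is finite, symmetric, and for all $x\ne y$ in $\mathbb Z^d$ there are $x_0=x,x_1,\dots,x_k=y$ with $x_{i+1}-x_i\in\mathcal N$. $\mathcal N_*\subset\mathcal N$ is a fixed subset such that $\mathcal N$ is the disjoint union of $\mathcal N_*$ and $-\mathcal N_*$. **Environment.** $(\Omega,\mathcal F,\mathbb P)$ is a probability space with expectation $\mathbb E$; $\mathbb Z^d$ acts on $\Omega$ by measurable maps $\tau_g$, $\tau_0=\mathrm{id}$, $\tau_g\circ\tau_{g'}=\tau_{g+g'}$. Stationarity: $\mathbb P(\tau_gA)=\mathbb P(A)$. Ergodicity: translation invariant measurable sets have probability $0$ or $1$. For $\xi\in\Omega$, $x,y\in\mathbb Z^d$, the conductance $c_{x,y}(\xi)=c_{y,x}(\xi)\ge0$ is measurable in $\xi$, strictly positive iff $y-x\in\mathcal N$, and covariant: $c_{x+z,y+z}(\xi)=c_{x,y}(\tau_z\xi)$. **Notation.** $L^2(\mathbb P)$ consists of complex functions, with $\langle f,g\rangle=\int\overline fg\,d\mathbb P$; $L_R^2(\mathbb P)$ of real ones. For $u:\Omega\to\mathbb C$, $\nabla u(\xi,z):=u(\tau_z\xi)-u(\xi)$, $z\in\mathcal N$. $\gamma(\xi)=\sum_{z\in\mathcal N}c_{0,z}(\xi)z\in\mathbb R^d$, with components $\gamma_k$. **Operator $\mathbb L$.** Let $\mathcal E(f,g)=\frac12\sum_{z\in\mathcal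 N}\mathbb E[c_{0,z}(\xi)(f(\tau_z\xi)-f(\xi))(g(\tau_z\xi)-g(\xi))]$ with domain $\mathcal D(\mathcal E)=\{f\in L^2_R(\mathbb P):\sum_{z\in\mathcal N}\mathbb E[c_{0,z}(\xi)(f(\tau_z\xi)-f(\xi))^2]<+\infty\}$. $\mathbb L$ is the unique negative semidefinite self-adjoint operator on $L^2_R(\mathbb P)$ with $\mathcal D(\mathcal E)=\mathcal D(\sqrt{-\mathbb L})$ and $\|\sqrt{-\mathbb L}f\|^2=\mathcal E(f,f)$ on $\mathcal D(\mathcal E)$; it is extended to complex functions by $\mathbb L(f+ig)=\mathbb Lf+i\mathbb Lg$. The operator $i\omega-\mathbb L$ has a bounded inverse on $L^2(\mathbb P)$. **Matrix $\sigma(\omega)$** (limiting complex mobility matrix): $\sigma(\omega)_{j,k}=\sum_{z\in\mathcal N}\mathbb E[c_{0,z}]z_jz_k-2\langle\gamma_j,(i\omega-\mathbb L)^{-1}\gamma_k\rangle_{L^2(\mathbb P)}$, $j,k\in\{1,\dots,d\}$. *)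

(* Defs.v *)
From HB Require Import structures.
From mathcomp Require Import all_boot all_order all_algebra finmap.
From mathcomp Require Import all_classical all_reals all_analysis.
From mathcomp Require Export complex.

Set Implicit Arguments.
Unset Strict Implicit.
Unset Printing Implicit Defensive.

Import Order.TTheory GRing.Theory Num.Theory.

Local Open Scope classical_set_scope.
Local Open Scope ring_scope.
Local Open Scope complex_scope.

Section Lattice.
Context {d : nat}.
Implicit Types N Nstar : {fset 'rV[int]_d}.

Record good_neighbourhood N : Prop := GoodNeighbourhood {
  good_neighbourhood_neq0 : 0 \notin N;
  good_neighbourhood_sym : forall z, z \in N -> - z \in N;
  good_neighbourhood_connected : forall x y : 'rV[int]_d, x != y ->
    exists s : seq 'rV[int]_d,
      path (fun a b => b - a \in N) x s /\ last x s = y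
}.

Definition half_neighbourhood N Nstar : Prop :=
  N = (Nstar `|` [fset - z | z in Nstar])%fset /\
  [disjoint Nstar & [fset - z | z in Nstar]]%fset.

Definition euclidean_norm {R : realType} (z : 'rV[int]_d) : R :=
  Num.sqrt (\sum_(i < d) (z 0 i)%:~R ^+ 2).

Definition nearest_neighbours (R : realType) N : Prop :=
  forall z, (z \in N) = (@euclidean_norm R z == 1).

Definition unit_vector (j : 'I_d) : 'rV[int]_d := delta_mx 0 j.

Definition canonical_basis : {fset 'rV[int]_d} :=
  [fset unit_vector j | j in 'I_d]%fset.

End Lattice.

Section Environment.
Context {R : realType} {disp : measure_display} {Omega : measurableType disp}.
Context (P : probability Omega R) {d : nat}.
Implicit Type tau : 'rV[int]_d -> Omega -> Omega.
Implicit Type c : 'rV[int]_d -> 'rV[int]_d -> Omega -> R.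

Record measurable_action tau : Prop := MeasurableAction {
  action_measurable : forall g, measurable_fun [set: Omega] (tau g);
  action0 : forall xi, tau 0 xi = xi;
  actionD : forall g g' xi, tau g (tau g' xi) = tau (g + g') xi
}.

Definition stationary tau : Prop :=
  forall g (A : set Omega), measurable A -> P (tau g @` A) = P A.

Definition ergodic tau : Prop :=
  forall A : set Omega, measurable A -> (forall g, tau g @` A = A) ->
    P A = 0%E \/ P A = 1%E.

Record conductance_field (N : {fset 'rV[int]_d}) c : Prop :=
  ConductanceField {
  conductance_measurable : forall x y, measurable_fun [set: Omega] (c x y);
  conductance_sym : forall x y xi, c x y xi = c y x xi;
  conductance_ge0 : forall x y xi, 0 <= c x y xi;
  conductance_gt0 : forall x y xi, (0 < c x y xi) = (y - x \in N)
}.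

Definition covariant tau c : Prop :=
  forall x y z xi, c (x + z) (y + z) xi = c x y (tau z xi).

Definition nabla {V : zmodType} tau (u : Omega -> V) (z : 'rV[int]_d)
    (xi : Omega) : V :=
  u (tau z xi) - u xi.

End Environment.

(* Elements of L^2 are handled through representatives, i.e. genuine functions
   on Omega, and equality in L^2 is `f = g %[ae P]`. *)
Section SquareIntegrable.
Context {R : realType} {disp : measure_display} {Omega : measurableType disp}.
Context (P : probability Omega R).

Definition expect (X : Omega -> R) : R := fine 'E_P[X]%E.

Definition expectC (X : Omega -> R[i]) : R[i] :=
  expect (fun xi => complex.Re (X xi)) +i* expect (fun xi => complex.Im (X xi)).

Definition expect_mx {m n : nat} (M : Omega -> 'M[R[i]]_(m, n)) :
    'M[R[i]]_(m, n) :=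
  \matrix_(i, j) expectC (fun xi => M xi i j).

Definition L2R (f : Omega -> R) : Prop := f \in Lfun P 2%:E.

Definition innerR (f g : Omega -> R) : R := expect (fun xi => f xi * g xi).

Definition normR (f : Omega -> R) : R := fine ('N[P]_2%:E [EFin \o f])%E.

Definition L2C (f : Omega -> R[i]) : Prop :=
  L2R (fun xi => complex.Re (f xi)) /\ L2R (fun xi => complex.Im (f xi)).

Definition innerC (f g : Omega -> R[i]) : R[i] :=
  expectC (fun xi => conjc (f xi) * g xi).

Definition normC (f : Omega -> R[i]) : R :=
  Num.sqrt (complex.Re (innerC f f)).

Definition separable_L2C : Prop :=
  exists s : nat -> Omega -> R[i], (forall n, L2C (s n)) /\
    forall f, L2C f -> forall e : R, 0 < e ->
      exists n, normC (fun xi => f xi - s n xi) < e.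

End SquareIntegrable.

(* An unbounded operator A on L^2 is represented by its graph: `A f h` means
   that f belongs to the domain of A and that A f = h.  Graphs are saturated
   for almost-everywhere equality. *)
Section Operators.
Context {R : realType} {disp : measure_display} {Omega : measurableType disp}.
Context (P : probability Omega R).
Let opR := (Omega -> R) -> (Omega -> R) -> Prop.
Let opC := (Omega -> R[i]) -> (Omega -> R[i]) -> Prop.
Implicit Types A S : opR.

Record linear_operator A : Prop := LinearOperator {
  operator_L2 : forall f h, A f h -> L2R P f /\ L2R P h;
  operator_ae : forall f h f' h', L2R P f' -> L2R P h' ->
    f = f' %[ae P] -> h = h' %[ae P] -> A f h -> A f' h';
  operator_fun : forall f h h', A f h -> A f h' -> h = h' %[ae P];
  operator0 : A (fun=> 0) (fun=> 0);
  operator_linear : forall (a : R) f h f' h', A f h -> A f' h' ->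
    A (fun xi => a * f xi + f' xi) (fun xi => a * h xi + h' xi)
}.

Definition domain A (f : Omega -> R) : Prop := exists h, A f h.

Definition densely_defined A : Prop :=
  forall g, L2R P g -> forall e : R, 0 < e ->
    exists f, domain A f /\ normR P (fun xi => g xi - f xi) < e.

Definition adjoint A : opR := fun g k =>
  [/\ L2R P g, L2R P k & forall f h, A f h -> innerR P h g = innerR P f k].

Record self_adjoint A : Prop := SelfAdjoint {
  self_adjoint_linear : linear_operator A;
  self_adjoint_dense : densely_defined A;
  self_adjointE : forall f h, A f h <-> adjoint A f h
}.

Definition positive_semidefinite A : Prop :=
  forall f h, A f h -> 0 <= innerR P f h.

Definition negative_semidefinite A : Prop :=
  forall f h, A f h -> innerR P f h <= 0.

Definition opp_operator A : opR := fun f h => A f (fun xi => - h xi).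

(* S is the square root of A: S is self-adjoint, S >= 0, and S \o S = A with
   its natural domain. *)
Definition square_root A S : Prop :=
  [/\ self_adjoint S, positive_semidefinite S &
      forall f h, A f h <-> exists k, S f k /\ S k h].

Definition complexify A : opC := fun f h =>
  A (fun xi => complex.Re (f xi)) (fun xi => complex.Re (h xi)) /\
  A (fun xi => complex.Im (f xi)) (fun xi => complex.Im (h xi)).

Definition shifted_operator (lambda : R[i]) A : opC := fun f g =>
  L2C P g /\
  exists h, complexify A f h /\ (fun xi => lambda * f xi - h xi) = g %[ae P].

Record bounded_inverse (B : opC) (Res : (Omega -> R[i]) -> Omega -> R[i]) :
    Prop := BoundedInverse {
  inverseKr : forall g, L2C P g -> B (Res g) g;
  inverseKl : forall f g, B f g -> Res g = f %[ae P];
  inverse_bounded : exists M : R, forall g, L2C P g ->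
    normC P (Res g) <= M * normC P g
}.

End Operators.

Section DirichletForm.
Context {R : realType} {disp : measure_display} {Omega : measurableType disp}.
Context (P : probability Omega R) {d : nat}.
Context (N : {fset 'rV[int]_d}) (tau : 'rV[int]_d -> Omega -> Omega).
Context (c : 'rV[int]_d -> 'rV[int]_d -> Omega -> R).

Definition dirichlet_form (f g : Omega -> R) : R :=
  2^-1 * \sum_(z <- N)
    expect P (fun xi => c 0 z xi * (f (tau z xi) - f xi)
                                 * (g (tau z xi) - g xi)).

Definition dirichlet_domain (f : Omega -> R) : Prop :=
  L2R P f /\
  (\sum_(z <- N) 'E_P[(fun xi => c 0 z xi * (f (tau z xi) - f xi) ^+ 2)%R]
     < +oo)%E.

Definition is_generator (L : (Omega -> R) -> (Omega -> R) -> Prop) : Prop :=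
  [/\ self_adjoint P L, negative_semidefinite P L &
      exists S, [/\ square_root P (opp_operator L) S,
        forall f, domain S f <-> dirichlet_domain f &
        forall f h, S f h -> normR P h ^+ 2 = dirichlet_form f f]].

Definition gamma (k : 'I_d) (xi : Omega) : R :=
  \sum_(z <- N) c 0 z xi * (z 0 k)%:~R.

Definition gammaC (k : 'I_d) (xi : Omega) : R[i] := (gamma k xi)%:C.

(* `Res` stands for the inverse of i omega - L. *)
Definition mobility (Res : (Omega -> R[i]) -> Omega -> R[i]) : 'M[R[i]]_d :=
  \matrix_(j, k)
    ((\sum_(z <- N) expect P (c 0 z) * (z 0 j)%:~R * (z 0 k)%:~R)%:C
     - 2 * innerC P (gammaC j) (Res (gammaC k))).

Definition Lambda (z : 'rV[int]_d) (xi : Omega) : 'M[R[i]]_d :=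
  \matrix_(j, k) (c 0 z xi * (z 0 j)%:~R * (j == k)%:R)%:C.

Definition Zmat (z : 'rV[int]_d) : 'M[R[i]]_d :=
  \matrix_(j, k) (z 0 k)%:~R.

Definition Psi (theta : 'I_d -> Omega -> R[i]) (z : 'rV[int]_d) (xi : Omega) :
    'M[R[i]]_d :=
  \matrix_(j, k) nabla tau (theta k) z xi.

Definition Lambda_nn (xi : Omega) : 'M[R[i]]_d :=
  \matrix_(j, k) (c 0 (unit_vector j) xi * (j == k)%:R)%:C.

Definition Psi_nn (theta : 'I_d -> Omega -> R[i]) (xi : Omega) : 'M[R[i]]_d :=
  \matrix_(j, k) nabla tau (theta k) (unit_vector j) xi.

End DirichletForm.

(* Main.v *)
(** Symmetry and covariance give [c 0 (- z) (tau z xi) = c 0 z xi], so by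
    stationarity [E[c_{0,-z} f] = E[c_{0,z} (f \o tau_z)]] for [f] in L^2.
    Pairing [z] with [- z] in [<gamma_j, theta_k>] turns it into
    [- \sum_(z in Nstar) z_j E[c_{0,z} nabla theta_k(., z)]], and in the first
    term of the mobility matrix it doubles the sum over [Nstar]. *)

Require Import Defs.
From HB Require Import structures.
From mathcomp Require Import all_boot all_order all_algebra finmap.
From mathcomp Require Import all_classical all_reals all_analysis.
From mathcomp Require Import measurable_realfun ring.

Set Implicit Arguments.
Unset Strict Implicit.

Import Order.TTheory GRing.Theory Num.Theory.

Local Open Scope classical_set_scope.
Local Open Scope ring_scope.
Local Open Scope complex_scope.

(** * Expectations of real and complex variables, and membership in L^1 and L^2 *)

Section Expectation.
Context {R : realType} {disp : measure_display} {Omega : measurableType disp}.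
Context (P : probability Omega R).

Lemma expectD (X Y : Omega -> R) : X \in Lfun P 1 -> Y \in Lfun P 1 ->
  expect P (fun xi => X xi + Y xi) = expect P X + expect P Y.
Proof.
move=> X1 Y1; rewrite /expect.
by rewrite -[fun _ => _]/(X \+ Y) expectationD// fineD ?expectation_fin_num.
Qed.

Lemma expectB (X Y : Omega -> R) : X \in Lfun P 1 -> Y \in Lfun P 1 ->
  expect P (fun xi => X xi - Y xi) = expect P X - expect P Y.
Proof.
move=> X1 Y1; rewrite /expect.
by rewrite -[fun _ => _]/(X \- Y) expectationB// fineB ?expectation_fin_num.
Qed.

Lemma expectZr (X : Omega -> R) (a : R) : X \in Lfun P 1 ->
  expect P (fun xi => X xi * a) = expect P X * a.
Proof.
move=> X1; rewrite /expect.
rewrite -[fun _ => _]/(a \o* X) expectationZl// fineM ?expectation_fin_num//=.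
by rewrite mulrC.
Qed.

Lemma Lfun1_scale (X : Omega -> R) (a : R) : X \in Lfun P 1 ->
  (fun xi => X xi * a) \in Lfun P 1.
Proof. exact: Lfun_scale. Qed.

Lemma Lfun_sum (p : \bar R) (I : choiceType) (r : seq I)
    (X : I -> Omega -> R) : (1 <= p)%E ->
  (forall i, i \in r -> X i \in Lfun P p) ->
  (fun xi => \sum_(i <- r) X i xi) \in Lfun P p.
Proof.
move=> p1 X1; rewrite (_ : (fun _ => _) = \sum_(i <- r) X i); last first.
  by apply/funext => xi; rewrite fct_sumE.
by rewrite big_seq; apply: rpred_sum => // i /X1.
Qed.

Lemma expect_sum (I : choiceType) (r : seq I) (X : I -> Omega -> R) :
  (forall i, i \in r -> X i \in Lfun P 1) ->
  expect P (fun xi => \sum_(i <- r) X i xi) = \sum_(i <- r) expect P (X i).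
Proof.
elim: r => [|i r IH] X1.
  rewrite big_nil; under eq_fun do rewrite big_nil.
  by rewrite /expect expectation_cst.
under eq_fun do rewrite big_cons.
have X1r j : j \in r -> X j \in Lfun P 1 by move=> jr; rewrite X1// inE jr orbT.
by rewrite big_cons expectD ?IH// ?Lfun_sum// X1 ?mem_head.
Qed.

Lemma L2R_mul (f g : Omega -> R) : L2R P f -> L2R P g ->
  (fun xi => f xi * g xi) \in Lfun P 1.
Proof. exact: Lfun2_mul_Lfun1. Qed.

Lemma L2R_cst (a : R) : L2R P (fun=> a).
Proof. exact: Lfun_cst. Qed.

(** [Lfun] is defined by a real power of the absolute value; at exponent 2 this is the plain square,
    so measurability and a finite second moment suffice. *)
Lemma L2R_sqr_lty (f : Omega -> R) : measurable_fun [set: Omega] f ->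
  ('E_P[(fun xi => (f xi ^+ 2)%R)] < +oo)%E -> L2R P f.
Proof.
move=> mf fley; apply/andP; split; first by rewrite inE.
rewrite inE /= /finite_norm unlock poweR_lty//.
apply: le_lt_trans fley; rewrite unlock le_eqVlt; apply/orP; left; apply/eqP.
apply: eq_integral => x _ /=.
by rewrite powR_mulrn// -normrX ger0_norm ?sqr_ge0.
Qed.

Lemma sum_complex (I : Type) (r : seq I) (a b : I -> R) :
  \sum_(i <- r) (a i +i* b i) = (\sum_(i <- r) a i) +i* (\sum_(i <- r) b i).
Proof. by elim: r => [|i r IH]; rewrite ?big_nil// !big_cons IH. Qed.

Lemma Re_intDB (m : int) (u v : R[i]) :
  complex.Re (m%:~R + (u - v)) = m%:~R + (complex.Re u - complex.Re v).
Proof. by case: u v => [? ?] [? ?]; rewrite -(rmorph_int (real_complex R)). Qed.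

Lemma Im_intDB (m : int) (u v : R[i]) :
  complex.Im (m%:~R + (u - v)) = complex.Im u - complex.Im v.
Proof.
by case: u v => [? ?] [? ?]; rewrite -(rmorph_int (real_complex R)) /= add0r.
Qed.

(** A real factor does not mix real and imaginary parts; identities for real functions can thus be
    applied to each part of [u]. *)
Lemma expectC_realM (a : Omega -> R) (u : Omega -> R[i]) :
  expectC P (fun xi => (a xi)%:C * u xi) =
  expect P (fun xi => a xi * complex.Re (u xi)) +i*
  expect P (fun xi => a xi * complex.Im (u xi)).
Proof.
by rewrite /expectC; congr (_ +i* _); congr expect; apply/funext => xi;
  case: (u xi) => x y /=; rewrite mul0r ?subr0 ?addr0.
Qed.

End Expectation.

(** * Invariance of integrals under translations *)

Section Stationarity.
Context {R : realType} {disp : measure_display} {Omega : measurableType disp}.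
Context {P : probability Omega R} {d : nat}.
Context {tau : 'rV[int]_d -> Omega -> Omega}.
Hypotheses (htau : measurable_action tau) (hstat : stationary P tau).

(* Stationarity is phrased with direct images; as [tau g] is inverted by
   [tau (- g)], direct images are preimages. *)
Lemma pushforward_tau g (A : set Omega) : measurable A ->
  pushforward P (tau g) A = P A.
Proof.
move=> mA; rewrite /pushforward -(hstat (- g) mA); congr (P _).
apply/seteqP; split => [xi Axi | _ [xi Axi <-]] /=.
  by exists (tau g xi) => //; rewrite (actionD htau) addNr (action0 htau).
by rewrite (actionD htau) subrr (action0 htau).
Qed.

(** The two measures agree on measurable sets, so their integrals agree for every [f], integrable or
    not. *)
Lemma integral_pushforward_tau g (f : Omega -> \bar R) :
  (\int[pushforward P (tau g)]_x f x = \int[P]_x f x)%E.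
Proof.
apply: (eq_measure_integral P); first exact: (action_measurable htau).
by move=> mtau A mA _; exact: pushforward_tau.
Qed.

Lemma Lfun1_tau g (X : Omega -> R) : X \in Lfun P 1 ->
  X \o tau g \in Lfun P 1.
Proof.
have mtau := action_measurable htau g.
move=> /Lfun1_integrable /integrableP[mX Xley]; apply/Lfun1_integrable.
apply/integrableP; split.
  apply/measurable_EFinP; apply: (measurableT_comp _ mtau).
  exact/measurable_EFinP.
(* The integrals of the absolute values are in fact equal: replace [P] by its pushforward, then
   change variables. *)
apply: le_lt_trans Xley; rewrite le_eqVlt; apply/orP; left; apply/eqP.
rewrite -[RHS](integral_pushforward_tau g).
by rewrite ge0_integral_pushforward//; exact: measurableT_comp.
Qed.

Lemma expect_tau g (X : Omega -> R) : X \in Lfun P 1 ->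
  expect P (fun xi => X (tau g xi)) = expect P X.
Proof.
move=> X1; rewrite /expect unlock; congr fine.
have /Lfun1_integrable Xtau := Lfun1_tau g X1.
move/Lfun1_integrable : X1 => /integrableP[mX _].
rewrite -[RHS](integral_pushforward_tau g).
by rewrite integral_pushforward//; exact: (action_measurable htau).
Qed.

End Stationarity.

(** * Sums over [N], over its half, and over the canonical basis *)

Section HalfNeighbourhood.
Context {d : nat} {N Nstar : {fset 'rV[int]_d}}.
Hypothesis hNstar : half_neighbourhood N Nstar.

Lemma half_neighbourhood_sub z : z \in Nstar -> z \in N.
Proof. by case: hNstar => -> _ zN; rewrite in_fsetU zN. Qed.

Lemma half_neighbourhood_subN z : z \in Nstar -> - z \in N.
Proof.
by case: hNstar => -> _ zN; rewrite in_fsetU (in_imfset _ _ zN) orbT.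
Qed.

(** Disjointness makes [Nstar] followed by its negatives a duplicate-free list, hence a permutation
    of [N]. *)
Lemma big_half_neighbourhood (V : nmodType) (F : 'rV[int]_d -> V) :
  \sum_(z <- N) F z = \sum_(z <- Nstar) (F z + F (- z)).
Proof.
case: hNstar => NE dis; rewrite big_split /=.
rewrite -(big_map -%R xpredT F) -big_cat; apply/perm_big/uniq_perm.
- exact: fset_uniq.
- rewrite cat_uniq fset_uniq (map_inj_uniq (@oppr_inj _)) fset_uniq andbT /=.
  apply/hasPn => _ /mapP[z zN ->]; apply/negP => Nz.
  by have /fdisjointP/(_ _ Nz)/negP := dis; apply; exact: in_imfset.
- move=> z; rewrite NE in_fsetU mem_cat; congr orb.
  apply/imfsetP/mapP => -[y yN ->]; by exists y.
Qed.

End HalfNeighbourhood.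

Lemma unit_vectorE {d : nat} (i j : 'I_d) : unit_vector i 0 j = (j == i)%:Z.
Proof. by rewrite mxE eqxx natz. Qed.

Lemma big_canonical_basis {d : nat} (V : nmodType) (F : 'rV[int]_d -> V) :
  \sum_(z <- canonical_basis) F z = \sum_(i < d) F (unit_vector i).
Proof.
rewrite big_imfset/=; first by rewrite big_enum.
(* Injectivity of [unit_vector]: coordinate [i] is 1 for [unit_vector i] and 0 for every other
   one. *)
move=> i j _ _ /rowP/(_ i); rewrite !unit_vectorE eqxx.
by case: eqP.
Qed.

(** * Reversibility of the conductances and the entries of the mobility matrix *)

Section Conductances.
Context {R : realType} {disp : measure_display} {Omega : measurableType disp}.
Context {P : probability Omega R} {d : nat}.
Context {N Nstar : {fset 'rV[int]_d}} {tau : 'rV[int]_d -> Omega -> Omega}.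
Context {c : 'rV[int]_d -> 'rV[int]_d -> Omega -> R}.
Hypotheses (hNstar : half_neighbourhood N Nstar).
Hypotheses (htau : measurable_action tau) (hstat : stationary P tau).
Hypotheses (hc : conductance_field N c) (hcov : covariant tau c).
Hypothesis hc2 :
  forall z, z \in N -> ('E_P[(fun xi => (c 0 z xi ^+ 2)%R)] < +oo)%E.

(** By covariance the left side is [c z 0 xi]: the same bond, traversed backwards. *)
Lemma conductance_tau z xi : c 0 (- z) (tau z xi) = c 0 z xi.
Proof. by rewrite -hcov add0r addNr (conductance_sym hc). Qed.

Lemma conductance_L2 z : z \in N -> L2R P (c 0 z).
Proof.
by move=> zN; apply: L2R_sqr_lty (hc2 zN); exact: conductance_measurable hc _ _.
Qed.

(** The product is the translate by [tau z] of [c 0 (- z)] times [f], a product of two L^2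
    functions; this is why the membership condition bears on [- z]. *)
Lemma conductance_mul_tau_Lfun1 z f : - z \in N -> L2R P f ->
  (fun xi => c 0 z xi * f (tau z xi)) \in Lfun P 1.
Proof.
move=> zN f2; under eq_fun do rewrite -conductance_tau.
exact: (Lfun1_tau htau hstat z (L2R_mul (conductance_L2 zN) f2)).
Qed.

Lemma conductance_mul_nabla_Lfun1 z f : z \in N -> - z \in N -> L2R P f ->
  (fun xi => c 0 z xi * (f (tau z xi) - f xi)) \in Lfun P 1.
Proof.
move=> zN zN' f2; under eq_fun do rewrite mulrBr.
exact: rpredB (conductance_mul_tau_Lfun1 zN' f2)
  (L2R_mul (conductance_L2 zN) f2).
Qed.

Lemma expect_conductanceN z f : - z \in N -> L2R P f ->
  expect P (fun xi => c 0 (- z) xi * f xi) =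
  expect P (fun xi => c 0 z xi * f (tau z xi)).
Proof.
move=> zN f2.
rewrite -(expect_tau htau hstat z (L2R_mul (conductance_L2 zN) f2)).
by under eq_fun do rewrite conductance_tau.
Qed.

(** This is [expect_conductanceN] for the constant function 1. *)
Lemma expect_conductance_sym z : - z \in N ->
  expect P (c 0 (- z)) = expect P (c 0 z).
Proof.
move=> zN; have := expect_conductanceN zN (L2R_cst P 1).
have mulr1_fun w : (fun xi => c 0 w xi * 1) = c 0 w.
  by apply/funext => xi; rewrite mulr1.
by rewrite !mulr1_fun.
Qed.

(* Reversibility folds the contributions of [z] and [- z] into a gradient. *)
Lemma expect_gamma_mul j f : L2R P f ->
  expect P (fun xi => gamma N c j xi * f xi) =
  - \sum_(z <- Nstar)
      expect P (fun xi => c 0 z xi * (f (tau z xi) - f xi)) * (z 0 j)%:~R.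
Proof.
move=> f2.
have cf1 z : z \in N -> (fun xi => c 0 z xi * f xi) \in Lfun P 1.
  by move=> zN; exact: L2R_mul (conductance_L2 zN) f2.
(* The coordinate [z 0 j] is moved to the far right, where [expectZr] takes it out of the
   expectation. *)
under eq_fun => xi do [rewrite mulr_suml;
  under eq_bigr => z _ do rewrite mulrAC].
rewrite expect_sum; last by move=> z zN; exact/Lfun1_scale/cf1.
rewrite big_seq; under eq_bigr => z zN do rewrite (expectZr _ (cf1 z zN)).
rewrite -big_seq (big_half_neighbourhood hNstar) -sumrN.
rewrite big_seq [RHS]big_seq; apply: eq_bigr => z zN.
have zN1 := half_neighbourhood_subN hNstar zN.
rewrite (expect_conductanceN zN1 f2).
under [in RHS]eq_fun do rewrite mulrBr.
rewrite (expectB (conductance_mul_tau_Lfun1 zN1 f2)); last first.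
  exact/cf1/(half_neighbourhood_sub hNstar).
(* The coordinate of [- z] is the opposite of that of [z], which turns the sum of the two
   contributions into a difference. *)
by rewrite mxE mulrNz mulrN -mulrBl -mulNr opprB.
Qed.

Lemma gamma_L2 j : L2R P (gamma N c j).
Proof.
apply: Lfun_sum => [|z zN]; first by rewrite lee1n.
by apply: Lfun_scale; [rewrite ler1n | exact: conductance_L2].
Qed.

Lemma gammaC_L2 j : L2C P (gammaC N c j).
Proof. by split; [exact: gamma_L2 | exact: L2R_cst]. Qed.

(** [expect_gamma_mul] applies to both parts of [theta]; the minus sign it yields cancels the one
    before the inner product, so gradient terms add to the [z_k] terms. *)
Lemma mobility_entry (Res : (Omega -> R[i]) -> Omega -> R[i]) j k :
  L2C P (Res (gammaC N c k)) ->
  mobility P N c Res j k = 2 * \sum_(z <- Nstar)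
    expectC P (fun xi => (c 0 z xi * (z 0 j)%:~R)%:C *
                         ((z 0 k)%:~R + nabla tau (Res (gammaC N c k)) z xi)).
Proof.
set theta := Res _ => -[theta_Re theta_Im].
rewrite mxE /innerC -/theta.
(* The conjugation in the inner product disappears because [gamma] is real. *)
rewrite [X in expectC P X](_ : _ = fun xi => (gamma N c j xi)%:C * theta xi);
  last by apply/funext => xi; rewrite /gammaC conjc_real.
rewrite expectC_realM !expect_gamma_mul//.
rewrite (big_half_neighbourhood hNstar).
(* Both coordinates change sign with [z] and the mean conductance does not, so [z] and [- z]
   contribute equally; the resulting 2 matches the one before the inner product. *)
have -> : \sum_(z <- Nstar)
    (expect P (c 0 z) * (z 0 j)%:~R * (z 0 k)%:~R +
     expect P (c 0 (- z)) * ((- z) 0 j)%:~R * ((- z) 0 k)%:~R) =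
  2 * \sum_(z <- Nstar) expect P (c 0 z) * (z 0 j)%:~R * (z 0 k)%:~R.
  rewrite mulr_sumr big_seq [RHS]big_seq; apply: eq_bigr => z zN.
  rewrite expect_conductance_sym ?(half_neighbourhood_subN hNstar)//.
  by rewrite !mxE !mulrNz !mulrN !mulNr opprK mulr_natl mulr2n.
rewrite rmorphM rmorph_nat -mulrBr; congr (2 * _).
under [RHS]eq_bigr do rewrite expectC_realM.
rewrite sum_complex; apply/eqP; rewrite eq_complex /= sub0r !opprK.
apply/andP; split; apply/eqP; rewrite -?big_split big_seq [RHS]big_seq;
  apply: eq_bigr => z zN /=.
all: have cz := conductance_L2 (half_neighbourhood_sub hNstar zN).
all: have cnabla1 f := @conductance_mul_nabla_Lfun1 z f
       (half_neighbourhood_sub hNstar zN) (half_neighbourhood_subN hNstar zN).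
(* Real part: the integer [z_k] contributes here, and its term is integrable since L^2 is contained
   in L^1 for a finite measure. *)
- have cz1 : c 0 z \in Lfun P 1.
    by apply: Lfun_subset12 cz; exact: fin_num_measure.
  rewrite -mulrA -(expectZr _ cz1) -(expectZr _ (cnabla1 _ theta_Re)).
  rewrite -expectD ?Lfun1_scale ?(cnabla1 _ theta_Re)//.
  congr expect; apply/funext => xi.
  by rewrite Re_intDB; ring.
(* Imaginary part: [z_k] is real, so only the gradient remains. *)
- rewrite -(expectZr _ (cnabla1 _ theta_Im)).
  by congr expect; apply/funext => xi; rewrite Im_intDB mulrAC.
Qed.

End Conductances.

(** * Square integrability of the resolvent, and the matrix and nearest-neighbour forms *)

Lemma resolvent_L2 {R : realType} {disp : measure_display}
    {Omega : measurableType disp} {P : probability Omega R} {d : nat}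
    {N : {fset 'rV[int]_d}} {tau : 'rV[int]_d -> Omega -> Omega}
    {c : 'rV[int]_d -> 'rV[int]_d -> Omega -> R} {lambda : R[i]}
    {L : (Omega -> R) -> (Omega -> R) -> Prop}
    {Res : (Omega -> R[i]) -> Omega -> R[i]} (g : Omega -> R[i]) :
  is_generator P N tau c L ->
  bounded_inverse P (shifted_operator P lambda L) Res ->
  L2C P g -> L2C P (Res g).
Proof.
move=> [Lsa _ _] hRes g2.
(* Both parts of [Res g] lie in the domain of [L], whose graph consists of pairs of L^2
   functions. *)
have [_ [h [[LRe LIm] _]]] := inverseKr hRes g2.
have L2 := operator_L2 (self_adjoint_linear Lsa).
by split; [have [] := L2 _ _ LRe | have [] := L2 _ _ LIm].
Qed.

Theorem proposition2p8 (R : realType) (disp : measure_display)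
  (Omega : measurableType disp) (P : probability Omega R) (d : nat)
  (N Nstar : {fset 'rV[int]_d}) (tau : 'rV[int]_d -> Omega -> Omega)
  (c : 'rV[int]_d -> 'rV[int]_d -> Omega -> R) (omega : R)
  (L : (Omega -> R) -> (Omega -> R) -> Prop)
  (Res : (Omega -> R[i]) -> Omega -> R[i])
  (homega : 0 < omega)
  (hN : good_neighbourhood N) (hNstar : half_neighbourhood N Nstar)
  (htau : measurable_action tau)
  (hstat : stationary P tau) (herg : ergodic P tau)
  (hsep : separable_L2C P)
  (hc : conductance_field N c) (hcov : covariant tau c)
  (hc2 : forall z, z \in N -> ('E_P[(fun xi => (c 0 z xi ^+ 2)%R)] < +oo)%E)
  (hL : is_generator P N tau c L)
  (hRes : bounded_inverse P (shifted_operator P (0 +i* omega) L) Res) :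
  let theta (k : 'I_d) : Omega -> R[i] := Res (gammaC N c k) in
  let sigma : 'M[R[i]]_d := mobility P N c Res in
  [/\ forall j k : 'I_d,
        sigma j k = 2 * \sum_(z <- Nstar)
          expectC P (fun xi => (c 0 z xi * (z 0 j)%:~R)%:C *
                               ((z 0 k)%:~R + nabla tau (theta k) z xi)),
      sigma = 2 *: \sum_(z <- Nstar)
        expect_mx P (fun xi => Lambda c z xi *m (Zmat z + Psi tau theta z xi)) &
      nearest_neighbours R N -> Nstar = canonical_basis ->
        (forall j k : 'I_d,
           sigma j k = 2 * expectC P (fun xi => (c 0 (unit_vector j) xi)%:C *
             ((j == k)%:R + nabla tau (theta k) (unit_vector j) xi))) /\
        sigma = 2 *: expect_mx P (fun xi =>
                  Lambda_nn c xi *m (1%:M + Psi_nn tau theta xi))].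
Proof.
move=> theta sigma.
have sigmaE j k : sigma j k = 2 * \sum_(z <- Nstar)
    expectC P (fun xi => (c 0 z xi * (z 0 j)%:~R)%:C *
                         ((z 0 k)%:~R + nabla tau (theta k) z xi)).
  apply: (mobility_entry hNstar htau hstat hc hcov hc2).
  exact: resolvent_L2 hL hRes (gammaC_L2 hc hc2 k).
split=> [//||nn NstarE].
- apply/matrixP => j k; rewrite sigmaE !mxE summxE; congr (2 * _).
  apply: eq_bigr => z _; rewrite mxE; congr expectC; apply/funext => xi.
  (* [Lambda] is diagonal, so only the index [j] survives in the matrix product. *)
  rewrite mxE (bigD1 j)//= big1 ?addr0 => [|i ij].
    by rewrite !mxE eqxx mulr1.
  by rewrite !mxE eq_sym (negbTE ij) mulr0 mul0r.
have sigma_nn j k : sigma j k = 2 * expectC P (fun xi =>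
    (c 0 (unit_vector j) xi)%:C *
    ((j == k)%:R + nabla tau (theta k) (unit_vector j) xi)).
  (* The factor [z 0 j] kills every basis vector but the [j]-th, and [z 0 k] then becomes the
     Kronecker delta. *)
  rewrite sigmaE NstarE big_canonical_basis (bigD1 j)//= big1 ?addr0 => [|i ij].
    congr (2 * expectC P _); apply/funext => xi.
    by rewrite !unit_vectorE eqxx mulr1 eq_sym.
  (* The zero integrand is written as a real factor times a complex one to fit [expectC_realM]. *)
  rewrite [X in expectC P X](_ : _ = fun xi => 0%:C * 0).
    by rewrite expectC_realM /= mul0r /expect expectation_cst.
  by apply/funext => xi; rewrite unit_vectorE eq_sym (negbTE ij) mulr0 !mul0r.
split=> //; apply/matrixP => j k; rewrite sigma_nn !mxE; congr (2 * _).
congr expectC; apply/funext => xi.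
rewrite mxE (bigD1 j)//= big1 ?addr0 => [|i ij].
  by rewrite !mxE eqxx mulr1.
by rewrite !mxE eq_sym (negbTE ij) mulr0 mul0r.
Qed.
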